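(* Let $a\in\mathbb N$ and $k=a(a+1)+1$. Then $\Delta(J_k(a))=a(a+1)$ and the Jaconian set of $J_k(a)$ is $\{v_{a+1}\}$; moreover $J_k(a)$ is the smallest Jaco graph in $\{J_n(a):n\in\mathbb N\}$ with these two properties, i.e. for no $n<k$ does $J_n(a)$ have $\Delta(J_n(a))=a(a+1)$ and Jaconian set $\{v_{a+1}\}$.
   Context: For $a\in\mathbb N$, the infinite Jaco graph $J_\infty(a)$ is the directed graph with vertex set $\{v_i:i\in\mathbb N\}$ in which every arc has the form $(v_i,v_j)$ with $i<j$, and for $i<j$, $(v_i,v_j)$ is an arc iff $(a+1)i-d^-(v_i)\ge j$, where $d^-(v_i)$ is the in-degree of $v_i$ (determined recursively). For $n\in\mathbb N$, the finite Jaco graph $J_n(a)$ is the subgraph of $J_\infty(a)$ induced on $\{v_1,\dots,v_n\}$. Degrees are taken in the underlying undirected graph (in-degree plus out-degree in $J_n(a)$), $\Delta(J_n(a))$ is the maximum degree, and the Jaconian set of $J_n(a)$ is the set of vertices of degree $\Delta(J_n(a))$. *)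

(* Defs.v *)
From mathcomp Require Import all_boot finmap.

Set Implicit Arguments.
Unset Strict Implicit.
Unset Printing Implicit Defensive.

Local Open Scope fset_scope.
Local Open Scope nat_scope.

Record fdigraph := FDigraph {
  vertices : {fset nat};
  arc : rel nat;
}.

Definition indegree (G : fdigraph) (v : nat) : nat :=
  #|` [fset u in vertices G | arc G u v]|.

Definition outdegree (G : fdigraph) (v : nat) : nat :=
  #|` [fset u in vertices G | arc G v u]|.

Definition degree (G : fdigraph) (v : nat) : nat :=
  indegree G v + outdegree G v.

Definition max_degree (G : fdigraph) : nat :=
  \max_(v <- vertices G) degree G v.

Definition jaconian_set (G : fdigraph) : {fset nat} :=
  [fset v in vertices G | degree G v == max_degree G].

Definition induced (e : rel nat) (V : {fset nat}) : fdigraph :=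
  FDigraph V (fun i j => [&& i \in V, j \in V & e i j]).

(* The in-degrees of v_1, ..., v_m in the infinite Jaco graph: v_m.+1 receives
   an arc from each v_i with 1 <= i <= m and (a + 1) i - d^-(v_i) >= m + 1. *)
Fixpoint jaco_indegrees (a m : nat) : seq nat :=
  if m is m'.+1 then
    let d := jaco_indegrees a m' in
    rcons d (count (fun i => m'.+1 <= a.+1 * i - nth 0 d i.-1) (iota 1 m'))
  else [::].

Definition jaco_indegree (a i : nat) : nat := nth 0 (jaco_indegrees a i) i.-1.

(* The number i >= 1 stands for the vertex v_i; 0 is not a vertex. The truncated
   subtraction is harmless: it can only differ from the integer one when the
   latter is negative, and then both versions of the test fail since j > 0. *)
Definition jaco_arc (a : nat) : rel nat :=
  fun i j => [&& 0 < i, i < j & j <= a.+1 * i - jaco_indegree a i].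

Definition jaco (a n : nat) : fdigraph :=
  induced (jaco_arc a) [fset i in iota 1 n].

Lemma size_jaco_indegrees a m : size (jaco_indegrees a m) = m.
Proof. by elim: m => //= m IHm; rewrite size_rcons IHm. Qed.

Lemma nth_jaco_indegrees a m i :
  0 < i <= m -> nth 0 (jaco_indegrees a m) i.-1 = jaco_indegree a i.
Proof.
case/andP=> i_gt0; elim: m => [|m IHm]; first by rewrite leqNgt i_gt0.
rewrite leq_eqVlt => /predU1P[->//|]; rewrite ltnS => le_im.
by rewrite /= nth_rcons size_jaco_indegrees prednK // le_im IHm.
Qed.

Lemma card_iota_fset (P : pred nat) n :
  #|` [fset u in [fset i in iota 1 n] | P u]| = count P (iota 1 n).
Proof.
rewrite -size_filter -(undup_id (filter_uniq P (iota_uniq 1 n))) -card_fseq.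
by apply/eqP; rewrite -(_ : [fset u in [fset i in iota 1 n] | P u]
  = [fset x in [seq x <- iota 1 n | P x]]) //;
  apply/fsetP=> x; rewrite !inE mem_filter andbC.
Qed.

(* The recursively computed numbers are the in-degrees of the infinite graph:
   every arc into v_j comes from some v_i with i < j. *)
Lemma jaco_indegreeE a n j :
  0 < j <= n -> indegree (jaco a n) j = jaco_indegree a j.
Proof.
case/andP=> j_gt0 le_jn; rewrite /indegree /= card_iota_fset.
case: j => // j in j_gt0 le_jn *.
rewrite /jaco_indegree /= nth_rcons size_jaco_indegrees ltnn eqxx.
have iotaE: iota 1 n = iota 1 j ++ iota j.+1 (n - j).
  by rewrite -{1}(subnKC (ltnW le_jn)) iotaD.
rewrite [X in count _ X]iotaE count_cat -[RHS]addn0.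
congr addn.
  apply: eq_in_count => i; rewrite mem_iota add1n ltnS => /andP[i_gt0 le_ij].
  rewrite /jaco_arc !inE !mem_iota !add1n !ltnS i_gt0 le_ij le_jn.
  by rewrite (leq_trans le_ij (ltnW le_jn)) /= nth_jaco_indegrees ?i_gt0.
apply/eqP; rewrite -leqn0 leqNgt -has_count; apply/hasPn=> i.
rewrite mem_iota => /andP[lt_ji _].
by rewrite /jaco_arc (ltnNge i) lt_ji !andbF.
Qed.

(* Main.v *)
Require Import Defs.
From mathcomp Require Import all_boot finmap zify.

(** For [i <= a + 1] every earlier vertex is adjacent to [v_i], so
    [d^-(v_i) = i - 1] and the out-neighbours of [v_i] reach exactly up to
    [v_(a i + 1)].  Hence [v_(a+1)] is adjacent to all other vertices of [J_k(a)],
    while an earlier vertex misses [v_k] and a later one misses [v_1].  A graph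
    [J_n(a)] with [n < k] has too few vertices for a degree of [k - 1]. *)

Set Implicit Arguments.
Unset Strict Implicit.
Unset Printing Implicit Defensive.

Definition jaco_adj (a u v : nat) : bool := jaco_arc a u v || jaco_arc a v u.

Lemma mem_jaco_vertices a n v : (v \in vertices (jaco a n)) = (0 < v <= n).
Proof. by rewrite /= in_fset /= mem_iota add1n ltnS. Qed.

Lemma count_predU_disjoint (T : Type) (P Q : pred T) (s : seq T) :
  (forall x, P x -> ~~ Q x) -> count (predU P Q) s = count P s + count Q s.
Proof.
move=> PQ0; rewrite -count_predUI (@eq_count _ (predI P Q) pred0) ?count_pred0 ?addn0 //.
by move=> x /=; case Px: (P x); rewrite ?(negbTE (PQ0 x Px)).
Qed.

(* Counting the closed neighbourhood makes "adjacent to all other vertices"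
   equivalent to the count being [n]. *)
Lemma degreeS_jaco a n v : 0 < v <= n ->
  (degree (jaco a n) v).+1 =
  count (fun u => (u == v) || jaco_adj a u v) (iota 1 n).
Proof.
move=> v_n; rewrite /degree /indegree /outdegree /= !card_iota_fset.
(* In-neighbours of [v] lie below [v] and out-neighbours above it, so the two counts add up. *)
rewrite -count_predU_disjoint; last by move=> u; rewrite /jaco_arc; lia.
have v1 : count (pred1 v) (iota 1 n) = 1.
  by rewrite count_uniq_mem ?iota_uniq // mem_iota; lia.
rewrite -add1n -[X in X + _]v1 -count_predU_disjoint; last first.
  by move=> u /eqP-> /=; rewrite /jaco_arc; lia.
apply: eq_in_count => u; rewrite mem_iota => u_n.
rewrite /jaco_adj /= !in_fset /= !mem_iota.
have -> : 1 <= u < 1 + n by lia.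
by have -> : 1 <= v < 1 + n by lia.
Qed.

Lemma degree_jaco_lt a n v : 0 < v <= n -> degree (jaco a n) v < n.
Proof.
by move=> v_n; rewrite degreeS_jaco // (leq_trans (count_size _ _)) ?size_iota.
Qed.

Lemma degreeS_jaco_eq a n v : 0 < v <= n ->
  reflect (forall u, 0 < u <= n -> u != v -> jaco_adj a u v)
          ((degree (jaco a n) v).+1 == n).
Proof.
move=> v_n; rewrite degreeS_jaco // -[X in _ == X](size_iota 1 n) -all_count.
apply: (iffP allP) => adj u.
  by move=> u_n /negbTE uv; have := adj u; rewrite uv mem_iota; apply; lia.
by rewrite mem_iota => u_n; case: eqVneq => //= uv; apply: adj => //; lia.
Qed.

Lemma max_degree_jaco_lt a n : 0 < n -> max_degree (jaco a n) < n.
Proof.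
move=> n_gt0; rewrite -(prednK n_gt0) ltnS; apply/bigmax_leqP_seq => v.
rewrite mem_jaco_vertices => v_n _.
by have := degree_jaco_lt a v_n; lia.
Qed.

Lemma degree_le_max_degree (G : fdigraph) v :
  v \in vertices G -> degree G v <= max_degree G.
Proof. by move=> vG; apply: bigmax_sup_seq vG _ _. Qed.

(** Strong induction: an earlier [j >= 1] has in-degree [j - 1], so its arcs reach up to
    [a * j + 1 >= a + 1 >= i]. *)
Lemma jaco_indegree_small a i : 0 < i <= a.+1 -> jaco_indegree a i = i.-1.
Proof.
elim/ltn_ind: i => -[//|i] IH /andP[_ le_ia].
rewrite /jaco_indegree /= nth_rcons size_jaco_indegrees ltnn eqxx.
rewrite -[RHS](size_iota 1 i); apply/eqP; rewrite -all_count.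
apply/allP=> j; rewrite mem_iota => j_i.
rewrite nth_jaco_indegrees; last by lia.
rewrite IH; nia.
Qed.

(** The last out-neighbour is [a.+1 * i - (i - 1) = a * i + 1]. *)
Lemma jaco_arc_small a i j : 0 < i <= a.+1 ->
  jaco_arc a i j = (i < j <= a * i + 1).
Proof. by move=> i_a; rewrite /jaco_arc jaco_indegree_small //; nia. Qed.

Theorem theorem2p4 (a : nat) (a_gt0 : 0 < a) :
  let k := a * (a + 1) + 1 in
  [/\ max_degree (jaco a k) = a * (a + 1),
      jaconian_set (jaco a k) = [fset (a + 1)%N]%fset
    & forall n : nat, 0 < n < k ->
        ~ (max_degree (jaco a n) = a * (a + 1) /\
           jaconian_set (jaco a n) = [fset (a + 1)%N]%fset)].
Proof.
move=> k.
have kE : k = (a * (a + 1)).+1 by rewrite /k addn1.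
have a_lt_k : a + 1 < k by rewrite /k; nia.
have a1_k : 0 < a + 1 <= k by lia.
have full_degree : (degree (jaco a k) (a + 1)).+1 = k.
  apply/eqP/degreeS_jaco_eq => // u u_k u_neq; rewrite /jaco_adj.
  rewrite (@jaco_arc_small a (a + 1)); last by lia.
  (* For [u < a + 1] the arc comes from [u], as [a + 1 <= a * u + 1]; for larger [u] it leaves
     [a + 1], whose reach is exactly [k]. *)
  case: (ltnP u (a + 1)) => u_a; first by rewrite jaco_arc_small; nia.
  by rewrite orbC; have -> : a + 1 < u <= a * (a + 1) + 1 by rewrite -/k; lia.
have maxE : max_degree (jaco a k) = a * (a + 1).
  have := @max_degree_jaco_lt a k; have := @degree_le_max_degree (jaco a k) (a + 1).
  by rewrite mem_jaco_vertices a1_k; lia.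
split=> //; last first.
  by move=> n /andP[n_gt0 n_k] [max_n _]; have := max_degree_jaco_lt a n_gt0; lia.
apply/fsetP => v; rewrite in_fset1 in_fset inE mem_jaco_vertices maxE.
apply/andP/eqP => [[v_k /eqP deg_v] | ->]; last by split; [|apply/eqP; lia].
have /eqP/degreeS_jaco_eq adj_v : (degree (jaco a k) v).+1 = k by lia.
case: (ltngtP v (a + 1)) => // v_a.
  (* Here [v <= a], so [v] reaches at most [a * a + 1 < k]. *)
  have := adj_v v_k k; rewrite /jaco_adj (@jaco_arc_small a v) /jaco_arc; nia.
(* Vertex [1] reaches only [a + 1 < v]. *)
have := adj_v v_k 1; rewrite /jaco_adj (@jaco_arc_small a 1) /jaco_arc; lia.
Qed.
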